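(* Let $e\ge 0$ and $t>1$ be integers, $q=(2e+1)t$, let $k$ be an integer and let $h_2=\frac{\gcd(2e+1,t)}{\gcd(2e+1,t,k)}$. (i) $LC_q(e,k)\simeq \mathbb{Z}_{t/h_2}\times\mathbb{Z}_{th_2}$ (isomorphic as groups). (ii) For a positive divisor $d$ of $t$, there exists $C\in LPL^{\infty}(2,e,q)$ such that $C\simeq\mathbb{Z}_{t/d}\times\mathbb{Z}_{td}$ (as groups) if and only if $d\mid\gcd(2e+1,t)$.
   Context: For $a\in\mathbb{Z}_q$ with representative $\tilde a\in\{0,\dots,q-1\}$ put $|a|_1=\min\{\tilde a,q-\tilde a\}$. The maximum metric on $\mathbb{Z}_q^n$ is $d(x,y)=\max_i|x_i-y_i|_1$, and $B(x,r)=\{y\in\mathbb{Z}_q^n: d(x,y)\le r\}$. $LPL^{\infty}(n,e,q)$ is the set of linear perfect codes with packing radius $e$, i.e. of subgroups $C$ of $(\mathbb{Z}_q^n,+)$ with $\#C>1$ such that $\mathbb{Z}_q^n$ is the disjoint union of the balls $B(c,e)$, $c\in C$. A generator matrix of a linear code $C\subseteq\mathbb{Z}_q^n$ is a matrix $M\in\mathcal{M}_n(\mathbb{Z})$ whose rows form a $\mathbb{Z}$-basis of $\Lambda_C=\pi^{-1}(C)$, where $\pi:\mathbb{Z}^n\to\mathbb{Z}_q^n$ is reduction modulo $q$ in each coordinate. With $d_1=\gcd(2e+1,t)$ and $h_1=\frac{2e+1}{d_1}$, $LC_q(e,k)$ denotes the perfect code in $LPL^{\infty}(2,e,q)$ whose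 generator matrix is $\begin{pmatrix}2e+1 & kh_1\\ 0& 2e+1\end{pmatrix}$, i.e. the subgroup of $\mathbb{Z}_q^2$ generated by the residue classes of its rows. *)

(* Defs.v *)
From mathcomp Require Import all_boot all_order all_algebra all_fingroup.

Set Implicit Arguments.
Unset Strict Implicit.
Unset Printing Implicit Defensive.

Import GroupScope.
Local Open Scope nat_scope.

(* Throughout, 'Z_q is Z/qZ only for q > 1. The additive group Z_q^n is the
   type 'rV['Z_q]_n, whose canonical finGroupType law is addition, so that its
   subgroups are the terms of type {group 'rV['Z_q]_n}. *)

Definition lee_norm (q : nat) (a : 'Z_q) : nat := minn a (q - a).

Definition max_dist (q n : nat) (x y : 'rV['Z_q]_n) : nat :=
  \max_(i < n) lee_norm (x ord0 i - y ord0 i)%R.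

Definition max_ball (q n : nat) (x : 'rV['Z_q]_n) (r : nat) :
    {set 'rV['Z_q]_n} :=
  [set y | max_dist x y <= r].

Definition LPL (n e q : nat) (C : {group 'rV['Z_q]_n}) : Prop :=
  [/\ 1 < #|C|,
      \bigcup_(c in C) max_ball c e = [set: 'rV['Z_q]_n]
    & {in C &, forall c c', c != c' ->
        [disjoint max_ball c e & max_ball c' e]}].

(* Coordinatewise reduction modulo q. *)
Definition redmod (q n : nat) (v : 'rV[int]_n) : 'rV['Z_q]_n :=
  map_mx (fun a : int => a%:~R%R) v.

Definition code_of_mx (q n : nat) (M : 'M[int]_n) : {group 'rV['Z_q]_n} :=
  <<[set redmod q (row i M) | i : 'I_n]>>%G.

Definition LC_mx (e t : nat) (k : int) : 'M[int]_2 :=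
  let m := 2 * e + 1 in
  let h1 := m %/ gcdn m t in
  (block_mx (m%:Z)%:M (k * h1%:Z)%:M
            0         (m%:Z)%:M : 'M[int]_(1 + 1))%R.

(* The code LC_q(e,k), intended for q = (2e+1)t with t > 1. *)
Definition LC (q e t : nat) (k : int) : {group 'rV['Z_q]_2} :=
  code_of_mx q (LC_mx e t k).

(* Z_a x Z_b for a, b > 0. The subgroup Zp a is trivial when a = 1, whereas
   the type 'Z_1 has two elements. *)
Definition ZxZ (a b : nat) : {group 'Z_a * 'Z_b} :=
  setX_group (Zp_group a) (Zp_group b).

(* Main.v *)
Require Import Defs.
From mathcomp Require Import all_boot all_order all_algebra all_fingroup.
From mathcomp Require Import all_solvable.
From mathcomp Require Import zify ring.

(** Put m = 2e + 1, g = gcd(m, t), h1 = m / g, c = gcd(g, k), h2 = g / c, so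
    that q = m t. All codes are handled as row spaces over Z_q
    ([code_of_mxE]).

    (i) The isomorphism type of a code is read off a Smith normal form of its
    generator matrix: if M = L D W with L, W invertible over the integers and
    D = diag(s1, s2), where s1 and s2 divide q, then L does not change the row
    space and W maps it automorphically, so that the code is a direct product
    of cyclic groups of orders q / s1 and q / s2 ([isog_code_smith]). The
    generator matrix of LC_q(e,k) is c h1 times the matrix with rows (h2, k')
    and (0, h2), where k = c k'. Here h2 and k' are coprime, and a Bezout
    relation u h2 + v k' = 1 completes the row (h2, k') to the unimodular basis
    (h2, k'), (-v, u), for which (0, h2) = v h2 (h2, k') + h2^2 (-v, u).
    The diagonal entries are therefore c h1 and c h1 h2^2 ([LC_mx_smith]), with
    cofactors t h2 and t / h2 in q = m t.

    (ii) If C is isomorphic to Z_{t/d} x Z_{td}, then its exponent is a multiple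
    of td. Any subgroup of Z_q^n has an exponent dividing q = mt; hence d
    divides m. Conversely, for d dividing g, the code LC_q(e, g/d) has h2 = d by
    (i), and it is perfect: the cubes of side m centered at the lattice
    generated by (m, b) and (0, m) form columns of cubes, shifted by multiples
    of b, which tile the plane, and the tiling is q-periodic as soon as m
    divides tb ([LPL_triangular]). *)

Set Implicit Arguments.
Unset Strict Implicit.
Unset Printing Implicit Defensive.

Import GroupScope GRing.Theory Num.Theory FinRing.Theory.
Local Open Scope nat_scope.

(** * Reduction modulo q *)

Lemma natr_Zp_eq0 q n : 1 < q -> ((n%:R : 'Z_q) == 0)%R = (q %| n).
Proof. by move=> q_gt1; rewrite -val_eqE /= val_Zp_nat. Qed.

Lemma intr_Zp_eq0 q (a : int) :
  1 < q -> ((a%:~R : 'Z_q) == 0)%R = (q %| `|a|).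
Proof.
move=> q_gt1; case: a => n; first exact: natr_Zp_eq0.
by rewrite NegzE mulrNz oppr_eq0 abszN; exact: natr_Zp_eq0.
Qed.

Lemma redmodB q n (u v : 'rV[int]_n) :
  redmod q (u - v)%R = (redmod q u - redmod q v)%R.
Proof. exact: map_mxB. Qed.

Lemma redmod_lift q n (y : 'rV['Z_q]_n) : {u : 'rV[int]_n | y = redmod q u}.
Proof.
exists (\row_i (nat_of_ord (y ord0 i))%:Z)%R.
by apply/rowP=> i; rewrite !mxE -[LHS]natr_Zp.
Qed.

Lemma redmod_eq0 q n (u : 'rV[int]_n) : 1 < q ->
  redmod q u = 0%R <-> forall i, q %| `|u ord0 i|.
Proof.
move=> q_gt1; split=> [/rowP u0 i | u0].
  by rewrite -intr_Zp_eq0 //; move/eqP: (u0 i); rewrite !mxE.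
by apply/rowP=> i; apply/eqP; rewrite !mxE intr_Zp_eq0.
Qed.

(** * Codes as row spaces *)

(** Scaling by an element of Z_q is an iterated addition, so that the group
    generated by the rows of M is already the Z_q-module that they span. *)
Lemma code_of_mxE q n (M : 'M[int]_n) :
  code_of_mx q M = [set (v *m map_mx intr M)%R | v : 'rV['Z_q]_n] :> {set _}.
Proof.
have gspan : group_set [set (v *m map_mx intr M)%R | v : 'rV['Z_q]_n].
  apply/group_setP; split.
    by apply/imsetP; exists 0%R; rewrite ?mul0mx.
  move=> _ _ /imsetP[u _ ->] /imsetP[v _ ->].
  by apply/imsetP; exists (u + v)%R; rewrite ?mulmxDl.
apply/eqP; rewrite eqEsubset; apply/andP; split.
  suff: code_of_mx q M \subset Group gspan by [].
  rewrite gen_subG; apply/subsetP=> _ /imsetP[i _ ->].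
  by apply/imsetP; exists (delta_mx 0 i)%R; rewrite // -rowE /redmod map_row.
apply/subsetP=> _ /imsetP[v _ ->]; rewrite mulmx_sum_row.
apply: (big_ind (fun c => c \in code_of_mx q M)) => [||i _].
- exact: group1.
- by move=> x y; apply: groupM.
- rewrite -[v _ _]natr_Zp scaler_nat -zmodXgE groupX // mem_gen //.
  by apply/imsetP; exists i => //; rewrite /redmod map_row.
Qed.

Lemma mem_code_of_mx q n (M : 'M[int]_n) c :
  reflect (exists u : 'rV[int]_n, c = redmod q (u *m M)%R)
          (c \in code_of_mx q M).
Proof.
rewrite code_of_mxE; apply: (iffP imsetP) => [[v _ ->]|[u ->]].
  have [u ->] := redmod_lift v.
  by exists u; rewrite /redmod map_mxM.
by exists (redmod q u); rewrite // /redmod map_mxM.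
Qed.

Lemma exponent_code q n (C : {group 'rV['Z_q]_n}) : 1 < q -> exponent C %| q.
Proof.
move=> q_gt1; apply/exponentP=> x _.
by rewrite zmodXgE -scaler_nat pchar_Zp // scale0r.
Qed.

Lemma dvdn_exponent_ZxZ a b : 1 < b -> b %| exponent (ZxZ a b).
Proof.
move=> b_gt1; pose x : 'Z_b := Zp1.
have ord_x : #[pair1g 'Z_a x] = b.
  by rewrite order_injm ?injm_pair1g ?inE // order_Zp1 Zp_cast.
by rewrite -[X in X %| _]ord_x dvdn_exponent // inE /= group1 /Zp b_gt1 inE.
Qed.

(** * The isomorphism type from a Smith normal form *)

Lemma cycle_scale q n (w : 'rV['Z_q]_n) c :
  reflect (exists a : 'Z_q, c = (a *: w)%R) (c \in <[w]>).
Proof.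
apply: (iffP (cycleP _ _)) => [[i ->]|[a ->]].
  by exists (i%:R)%R; rewrite zmodXgE scaler_nat.
by exists a; rewrite zmodXgE -scaler_nat natr_Zp.
Qed.

Lemma order_scale q n s (w : 'rV['Z_q]_n) : 1 < q -> s %| q ->
  (forall a : 'Z_q, (a *: w = 0)%R -> a = 0%R) -> #[(s%:R *: w)%R] = q %/ s.
Proof.
move=> q_gt1 sq w_free; have s_gt0 := dvdn_gt0 (ltnW q_gt1) sq.
have ordE i : (#[(s%:R *: w)%R] %| i) = (q %/ s %| i).
  rewrite order_dvdn zmodXgE -scaler_nat scalerA -natrM.
  rewrite -(dvdn_pmul2r s_gt0) divnK // -natr_Zp_eq0 //.
  by apply/eqP/eqP=> [/w_free | ->]; rewrite ?scale0r.
by apply/eqP; rewrite eqn_dvd ordE dvdnn -ordE dvdnn.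
Qed.

(** The rows w1, w2 of W stay a basis of Z_q^2 after reduction, and L only
    changes the coefficient vectors bijectively; so the code is the direct
    product of the cyclic groups generated by s1 w1 and s2 w2. *)
Lemma isog_code_smith q (s1 s2 : nat) (L W : 'M[int]_(1 + 1)) :
    1 < q -> s1 %| q -> s2 %| q -> L \in unitmx -> W \in unitmx ->
  code_of_mx q (L *m block_mx (s1%:Z)%:M 0 0 (s2%:Z)%:M *m W)%R
    \isog ZxZ (q %/ s1) (q %/ s2).
Proof.
move=> q_gt1 s1q s2q Lu Wu.
set U := map_mx intr W : 'M['Z_q]_(1 + 1).
have Uu : U \in unitmx by rewrite unitmxE det_map_mx rmorph_unit -?unitmxE.
set L' := map_mx intr L : 'M['Z_q]_(1 + 1).
have Lu' : L' \in unitmx by rewrite unitmxE det_map_mx rmorph_unit -?unitmxE.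
pose w1 := usubmx U; pose w2 := dsubmx U.
have wE (a b : 'Z_q) : (a *: w1 + b *: w2 = row_mx a%:M b%:M *m U)%R.
  by rewrite -[U in RHS]vsubmxK mul_row_col !mul_scalar_mx.
have w_free (a b : 'Z_q) : (a *: w1 + b *: w2 = 0)%R -> (a = 0 /\ b = 0)%R.
  rewrite wE -(mul0mx _ U) -row_mx0 => /(can_inj (mulmxK Uu))/eq_row_mx[].
  by move=> /matrixP/(_ ord0 ord0) + /matrixP/(_ ord0 ord0); rewrite !mxE.
have o1 : #[(s1%:R *: w1)%R] = q %/ s1.
  apply: order_scale => // a aw; apply: (proj1 (w_free a 0%R _)).
  by rewrite aw scale0r addr0.
have o2 : #[(s2%:R *: w2)%R] = q %/ s2.
  apply: order_scale => // a aw; apply: (proj2 (w_free 0%R a _)).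
  by rewrite aw scale0r addr0.
set x1 := (s1%:R *: w1)%R in o1; set x2 := (s2%:R *: w2)%R in o2.
apply: (@isog_dprod _ _ <[x1]> <[x2]> _ _ _ _ _ (setX_dprod _ _)); last first.
- by rewrite -o2; apply: isog_trans (isog_set1X _ _); rewrite isog_sym Zp_isog.
- by rewrite -o1; apply: isog_trans (isog_setX1 _ _); rewrite isog_sym Zp_isog.
rewrite dprodE; last 2 first.
- by apply: sub_abelian_cent2 (zmod_abelian setT) _ _; rewrite subsetT.
- apply/trivgP/subsetP=> c /setIP[/cycle_scale[a ->] /cycle_scale[b /eqP]].
  rewrite -subr_eq0 -scaleNr !scalerA => /eqP/w_free[-> _].
  by rewrite scale0r inE.
have memE (v : 'rV['Z_q]_(1 + 1)) (a b : 'Z_q) :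
    (v *m L' = row_mx a%:M b%:M)%R ->
    (v *m map_mx intr (L *m block_mx (s1%:Z)%:M 0 0 (s2%:Z)%:M *m W) =
       a *: x1 + b *: x2)%R.
  rewrite !map_mxM /= -/L' -/U !mulmxA => ->.
  rewrite map_block_mx !raddf0 !map_scalar_mx mul_row_block !mulmx0 addr0 add0r.
  by rewrite !scalerA wE !scalar_mxM.
apply/setP=> c; rewrite code_of_mxE; apply/mulsgP/imsetP.
  move=> [_ _ /cycle_scale[a ->] /cycle_scale[b ->] ->].
  exists (row_mx a%:M b%:M *m invmx L')%R => //.
  by rewrite (memE _ a b) // mulmxKV.
move=> [v _ ->]; set u := (v *m L')%R.
pose a := lsubmx u ord0 ord0; pose b := rsubmx u ord0 ord0.
exists (a *: x1)%R (b *: x2)%R.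
- by apply/cycle_scale; exists a.
- by apply/cycle_scale; exists b.
by rewrite (memE _ a b) // -mx11_scalar -mx11_scalar hsubmxK.
Qed.

(** * Balls in the maximum metric *)

Lemma lee_normP q e (z : 'Z_q) : 1 < q ->
  reflect (exists2 r : int, `|r| <= e & z = (r%:~R)%R) (lee_norm z <= e).
Proof.
move=> q_gt1; have z_lt : z < q by rewrite -[ltnRHS](Zp_cast q_gt1).
rewrite /lee_norm geq_min; apply: (iffP orP) => [[ze|ze]|[r re ->]].
- by exists z; rewrite // -[LHS]natr_Zp.
- exists (z%:Z - q%:Z)%R; first lia.
  rewrite intrB -[LHS]natr_Zp; have := pchar_Zp q_gt1.
  by rewrite -!pmulrn => ->; rewrite subr0.
- case: r re => r re.
    by left; rewrite -pmulrn val_Zp_nat //; apply: leq_trans (leq_mod _ _) re.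
  right; rewrite NegzE mulrNz -pmulrn.
  (* When q divides r + 1 the class is 0, and the bound holds because q <= e. *)
  case: (posnP (r.+1 %% q)) => [r0|rq].
    apply: leq_trans re.
    suff qr : q <= r.+1 by apply: leq_trans (leq_subr _ _) qr.
    by apply: dvdn_leq => //; rewrite /dvdn r0.
  suff ->: (- (r.+1)%:R : 'Z_q)%R = (q - r.+1 %% q)%:R%R.
    rewrite val_Zp_nat // modn_small; last lia.
    have := leq_mod r.+1 q; have := ltn_pmod r.+1 (ltnW q_gt1).
    by move: (r.+1 %% q) => x; lia.
  apply/eqP; rewrite eq_sym -addr_eq0 -natrD natr_Zp_eq0 // /dvdn -modnDmr.
  by rewrite subnK ?modnn // ltnW // ltn_pmod // ltnW.
Qed.

(** Balls are the reductions of cubes of integer vectors; this turns packing and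
    covering questions in Z_q^n into divisibility questions in Z^n. *)
Lemma max_ballP q n e (x y : 'rV['Z_q]_n) : 1 < q ->
  reflect (exists2 r : 'rV[int]_n,
             forall i, `|r ord0 i| <= e & (x - y)%R = redmod q r)
          (y \in max_ball x e).
Proof.
move=> q_gt1; rewrite inE.
apply: (iffP (bigmax_leqP _ _ _)) => [xy|[r re xyr] i _].
  have ex i : {r : int | (`|r| <= e) && ((x ord0 i - y ord0 i)%R == r%:~R%R)}.
    apply: sigW; have /(lee_normP _ _ q_gt1)[r re rE] := xy i isT.
    by exists r; rewrite re rE /=.
  exists (\row_i sval (ex i))%R => [i|].
    by rewrite mxE; case: (ex i) => r /= /andP[].
  by apply/rowP=> i; rewrite !mxE; case: (ex i) => r /= /andP[_ /eqP].
apply/lee_normP => //; exists (r ord0 i) => //.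
by move/rowP/(_ i): xyr; rewrite !mxE.
Qed.

(** * Tilings by columns of cubes *)

Lemma centered_divz e (y : int) :
  {a : int & {r : int | y = (a * (2 * e + 1)%:Z + r)%R & `|r| <= e}}.
Proof.
set m : int := (2 * e + 1)%:Z%R; have m0 : m != 0%R by rewrite /m; lia.
exists ((y + e%:Z) %/ m)%Z, (((y + e%:Z) %% m)%Z - e%:Z)%R.
  by rewrite addrA -divz_eq addrK.
have := modz_ge0 (y + e%:Z)%R m0; have := ltz_mod (y + e%:Z)%R m0.
by rewrite /m; move: (_ %% _)%Z => x; lia.
Qed.

Lemma ord_split11_ind (P : 'I_(1 + 1) -> Prop) :
  P (lshift 1 ord0) -> P (rshift 1 ord0) -> forall i, P i.
Proof.
move=> P0 P1 i; case: (splitP i) => j; rewrite ord1 => ij.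
  by rewrite (_ : i = lshift 1 ord0) //; apply: val_inj.
by rewrite (_ : i = rshift 1 ord0) //; apply: val_inj.
Qed.

(** Writing m = 2e + 1, the divisibility hypothesis says that the lattice with
    basis (m, b), (0, m) contains (q, 0): t (m, b) differs from it by a multiple
    of (0, m). *)
Lemma LPL_triangular e t q (b : int) : 1 < t -> q = (2 * e + 1) * t ->
    2 * e + 1 %| t * `|b| ->
  LPL e (code_of_mx q (block_mx ((2 * e + 1)%:Z)%:M b%:M 0
                                ((2 * e + 1)%:Z)%:M : 'M[int]_(1 + 1)))%R.
Proof.
set m := 2 * e + 1; move=> t_gt1 qE mtb.
have m_gt0 : 0 < m by rewrite /m; lia.
have q_gt1 : 1 < q by rewrite qE; nia.
set M := block_mx _ _ _ _.
have ME (a0 a1 : int) :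
    (row_mx a0%:M a1%:M *m M = row_mx (a0 * m%:Z)%:M (a0 * b + a1 * m%:Z)%:M)%R.
  by rewrite mul_row_block mulmx0 addr0 -!scalar_mxM -raddfD.
have rowE (u : 'rV[int]_(1 + 1)) :
    u = row_mx (u ord0 (lshift 1 ord0))%:M (u ord0 (rshift 1 ord0))%:M.
  rewrite -[LHS]hsubmxK [X in row_mx X]mx11_scalar.
  by rewrite [X in row_mx _ X]mx11_scalar !mxE.
split.
- rewrite cardG_gt1; apply/trivgPn.
  exists (redmod q (row_mx 1%:M 0%:M *m M)%R).
    by apply/mem_code_of_mx; eexists.
  rewrite zmod1gE; apply/eqP; rewrite ME.
  move=> /(redmod_eq0 _ q_gt1)/(_ (lshift 1 ord0)).
  rewrite row_mxEl mxE eqxx mulr1n mul1r absz_nat => /(dvdn_leq m_gt0).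
  by rewrite qE; nia.
- (* The column of cubes containing y is found from its first coordinate, then
     the cube within this column from the second one. *)
  apply/setP=> y; rewrite [RHS]inE; have [Y ->] := redmod_lift y.
  pose y0 := Y ord0 (lshift 1 ord0); pose y1 := Y ord0 (rshift 1 ord0).
  have [a0 [r0 y0E r0e]] := centered_divz e y0.
  have [a1 [r1 y1E r1e]] := centered_divz e (y1 - a0 * b)%R.
  apply/bigcupP; exists (redmod q (row_mx a0%:M a1%:M *m M)%R).
    by apply/mem_code_of_mx; eexists.
  apply/max_ballP => //; exists (- row_mx r0%:M r1%:M)%R.
    by apply: ord_split11_ind; rewrite mxE abszN ?row_mxEl ?row_mxEr mxE.
  rewrite -redmodB ME [Y]rowE -/y0 -/y1.
  rewrite !opp_row_mx add_row_mx -!raddfN -!raddfD /= y0E -/m.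
  rewrite -/m in y1E; have ->: y1 = (a0 * b + a1 * m%:Z + r1)%R.
    by rewrite -addrA -y1E; ring.
  by apply: congr1; congr (row_mx _%:M _%:M)%R; ring.
- (* If two balls meet, the difference of their centers lifts both to a lattice
     vector and to a vector s with entries at most 2e < m in absolute value.
     The first entry of s is 0 as it is a multiple of m; by the hypothesis on b
     the second entry is then a multiple of m too. *)
  move=> _ _ /mem_code_of_mx[u ->] /mem_code_of_mx[u' ->] cc'.
  rewrite -setI_eq0; apply: contraNT cc' => /set0Pn[y /setIP[]].
  move=> /(max_ballP _ _ _ q_gt1)[r re rE] /(max_ballP _ _ _ q_gt1)[r' r'e r'E].
  pose d := (u - u')%R; pose s := (r - r')%R.
  have sE : redmod q (d *m M)%R = redmod q s.
    by rewrite mulmxBl !redmodB -rE -r'E opprB addrA subrK.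
  suff s0 : s = 0%R.
    rewrite -subr_eq0 -redmodB -mulmxBl -/d sE s0.
    by apply/eqP/redmod_eq0 => // i; rewrite mxE.
  have s_small i : m %| `|s ord0 i| -> s ord0 i = 0%R.
    have := re i; have := r'e i => r'ei rei.
    have -> : (s ord0 i = r ord0 i - r' ord0 i)%R by rewrite !mxE.
    move=> ms; apply/eqP; rewrite -absz_eq0; apply/negPn/negP; rewrite -lt0n.
    by move=> /dvdn_leq/(_ ms); rewrite /m; lia.
  move: d s sE s_small => d s sE s_small.
  have /eqP := sE; rewrite -subr_eq0 -redmodB => /eqP/(redmod_eq0 _ q_gt1).
  rewrite [d]rowE; set d0 := d _ _; set d1 := d _ _; rewrite ME => dM.
  set i0 : 'I_(1 + 1) := lshift 1 ord0; set i1 : 'I_(1 + 1) := rshift 1 ord0.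
  have dM0 : (q%:Z %| (d0 * m%:Z - s ord0 i0)%R)%Z.
    by have := dM i0; rewrite mxE row_mxEl mxE eqxx mulr1n mxE.
  have dM1 : (q%:Z %| (d0 * b + d1 * m%:Z - s ord0 i1)%R)%Z.
    by have := dM i1; rewrite mxE row_mxEr mxE eqxx mulr1n mxE.
  have mq : (m%:Z %| q%:Z)%Z by rewrite qE; apply: dvdn_mulr.
  have s0 : s ord0 i0 = 0%R.
    apply: s_small; rewrite -[m]absz_nat -dvdzE.
    have -> : s ord0 i0 = (d0 * m%:Z - (d0 * m%:Z - s ord0 i0))%R by ring.
    by rewrite rpredB ?dvdz_mull // (dvdz_trans mq dM0).
  have s1 : s ord0 i1 = 0%R.
    apply: s_small; rewrite -[m]absz_nat -dvdzE.
    have -> : s ord0 i1 =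
      (d0 * b + d1 * m%:Z - (d0 * b + d1 * m%:Z - s ord0 i1))%R by ring.
    apply: rpredB (dvdz_trans mq dM1); apply: rpredD (dvdz_mull _ (dvdzz _)).
    have td0 : t %| `|d0|.
      move: dM0; rewrite s0 subr0 dvdzE abszM !absz_nat qE mulnC.
      by rewrite dvdn_pmul2r.
    by rewrite dvdzE abszM absz_nat (dvdn_trans mtb) ?dvdn_mul.
  by apply/rowP; apply: ord_split11_ind; rewrite mxE ?s0 ?s1.
Qed.

(** * The codes LC_q(e,k) *)

Lemma LC_mx_smith e t (k : int) :
  let m := 2 * e + 1 in let g := gcdn m t in let c := gcdn g `|k| in
  let h1 := m %/ g in let h2 := g %/ c in
  exists L W : 'M[int]_(1 + 1), [/\ L \in unitmx, W \in unitmx &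
    LC_mx e t k = (L *m block_mx ((c * h1 * h2 ^ 2)%:Z)%:M 0
                               0 ((c * h1)%:Z)%:M *m W)%R].
Proof.
move=> m g c h1 h2.
have g_gt0 : 0 < g by rewrite gcdn_gt0 /m addn1.
have c_gt0 : 0 < c by rewrite gcdn_gt0 g_gt0.
have gE : g = h2 * c by rewrite divnK ?dvdn_gcdl.
have mE : m = h1 * g by rewrite divnK ?dvdn_gcdl.
have [k' kE] : exists k' : int, k = (k' * c%:Z)%R.
  by apply/dvdzP; rewrite dvdzE dvdn_gcdr.
have [[u v] /= uv] : exists uv : int * int, (uv.1 * h2%:Z + uv.2 * k')%R = 1%R.
  have [u [v uv]] := Bezoutz g%:Z k; exists (u, v) => /=.
  have c0 : c%:Z%R != 0%R by rewrite -lt0n in c_gt0 *.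
  apply: (mulIf c0); rewrite mul1r mulrDl -!mulrA -kE -PoszM -gE uv.
  by rewrite /gcdz absz_nat.
have unitI (A B : 'M[int]_(1 + 1)) : (A *m B = 1%:M)%R -> A \in unitmx.
  by case/mulmx1_unit.
(* W has rows (-v, u) and (h2, k'); L records that (h2, k') is its second row
   and that (0, h2) = h2^2 (-v, u) + v h2 (h2, k'). *)
exists (block_mx 0 1%:M 1%:M (v * h2%:Z)%:M)%R,
       (block_mx (- v)%:M u%:M (h2%:Z)%:M k'%:M)%R; split.
- apply: (unitI _ (block_mx (- (v * h2%:Z))%:M 1%:M 1%:M 0)%R).
  rewrite mulmx_block !mul0mx !mulmx0 !mul1mx !mulmx1 !add0r !addr0 -raddfD.
  by rewrite addNr raddf0 -scalar_mx_block.
- apply: (unitI _ (block_mx (- k')%:M u%:M (h2%:Z)%:M v%:M)%R).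
  rewrite mulmx_block -!scalar_mxM -!raddfD /=.
  have -> : (- v * - k' + u * h2%:Z = 1 :> int)%R by apply: etrans uv; ring.
  have -> : (h2%:Z * u + k' * v = 1 :> int)%R by apply: etrans uv; ring.
  have -> : (- v * u + u * v = 0 :> int)%R by ring.
  have -> : (h2%:Z * - k' + k' * h2%:Z = 0 :> int)%R by ring.
  by rewrite raddf0 -scalar_mx_block.
rewrite /LC_mx -/m -/g -/h1 !mulmx_block.
rewrite !mul0mx !mulmx0 !mul1mx !add0r !addr0 !mul0mx !add0r.
rewrite -!scalar_mxM -!raddfD /=.
have mZ : m%:Z%R = (h1%:Z * h2%:Z * c%:Z)%R by rewrite -!PoszM -mulnA -gE -mE.
have s1Z : ((c * h1 * h2 ^ 2)%:Z = c%:Z * h1%:Z * (h2%:Z * h2%:Z))%R.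
  by rewrite -!PoszM -mulnn.
have s2Z : ((c * h1)%:Z = c%:Z * h1%:Z)%R by rewrite PoszM.
rewrite s1Z s2Z mZ kE -[0%R in LHS](raddf0 (@scalar_mx int 1)).
f_equal; f_equal; try ring; first by congr (_%:M)%R; ring.
apply: (@etrans _ _ (h1%:Z * h2%:Z * c%:Z * (u * h2%:Z + v * k'))%R); last ring.
by rewrite uv mulr1.
Qed.

Lemma isog_LC e t q k : 1 < t -> q = (2 * e + 1) * t ->
  let h2 := gcdn (2 * e + 1) t %/ gcdn (gcdn (2 * e + 1) t) `|k|%N in
  (LC q e t k \isog ZxZ (t %/ h2) (t * h2) : Prop).
Proof.
move=> t_gt1; set m := 2 * e + 1; set g := gcdn m t; set c := gcdn g _ => qE h2.
have m_gt0 : 0 < m by rewrite /m addn1.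
have g_gt0 : 0 < g by rewrite gcdn_gt0 m_gt0.
have c_gt0 : 0 < c by rewrite gcdn_gt0 g_gt0.
have gE : g = h2 * c by rewrite divnK ?dvdn_gcdl.
have h2_gt0 : 0 < h2 by move: g_gt0; rewrite gE muln_gt0 => /andP[].
have h2t : h2 %| t.
  by rewrite (dvdn_trans _ (dvdn_gcdr m t)) // -/g gE dvdn_mulr.
have [tE mE] : t = t %/ h2 * h2 /\ m = m %/ g * g by rewrite !divnK ?dvdn_gcdl.
set h1 := m %/ g in mE.
have q_gt1 : 1 < q by rewrite qE; nia.
have q1 : q = t %/ h2 * (c * h1 * h2 ^ 2).
  by rewrite qE [in LHS]tE mE gE; ring.
have q2 : q = t * h2 * (c * h1) by rewrite qE mE gE; ring.
have s2_gt0 : 0 < c * h1.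
  by move: (ltnW q_gt1); rewrite {1}q2 muln_gt0 => /andP[].
have s1_gt0 : 0 < c * h1 * h2 ^ 2 by rewrite muln_gt0 s2_gt0 expn_gt0 h2_gt0.
have [L [W [Lu Wu LCE]]] := LC_mx_smith e t k.
have -> : t %/ h2 = q %/ (c * h1 * h2 ^ 2) by rewrite q1 mulnK.
have -> : t * h2 = q %/ (c * h1) by rewrite q2 mulnK.
rewrite /LC LCE; apply: isog_code_smith => //.
- by rewrite q1 dvdn_mull.
- by rewrite q2 dvdn_mull.
Qed.

(** Since t h1 = m (t / g), the off-diagonal entry k h1 satisfies the
    periodicity condition. *)
Lemma LPL_LC e t q k : 1 < t -> q = (2 * e + 1) * t -> LPL e (LC q e t k).
Proof.
move=> t_gt1 qE; apply: (LPL_triangular t_gt1 qE).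
rewrite abszM absz_nat mulnCA dvdn_mull //.
rewrite muln_divCA ?dvdn_gcdl ?dvdn_gcdr //.
by rewrite dvdn_mulr.
Qed.

Theorem theorem3p14 (e t q : nat) (k : int)
    (t_gt1 : 1 < t) (q_def : q = (2 * e + 1) * t) :
  let h2 := gcdn (2 * e + 1) t %/ gcdn (gcdn (2 * e + 1) t) `|k|%N in
  (LC q e t k \isog ZxZ (t %/ h2) (t * h2)) /\
  (forall d : nat, 0 < d -> d %| t ->
     (exists C : {group 'rV['Z_q]_2},
        LPL e C /\ C \isog ZxZ (t %/ d) (t * d))
     <-> d %| gcdn (2 * e + 1) t).
Proof.
split; first exact: isog_LC.
move=> d d_gt0 dt; split=> [[C [_ isoC]]|dg].
  have q_gt1 : 1 < q by rewrite q_def; nia.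
  rewrite dvdn_gcd dt andbT -(dvdn_pmul2l (ltnW t_gt1)).
  rewrite [t * (_ + 1)]mulnC -q_def.
  apply: dvdn_trans (exponent_code C q_gt1).
  by rewrite (exponent_isog isoC) dvdn_exponent_ZxZ //; nia.
set g := gcdn _ _ in dg.
have g_gt0 : 0 < g by rewrite gcdn_gt0 addn1.
exists (LC q e t (g %/ d)%:Z); split; first exact: LPL_LC.
have := isog_LC (g %/ d)%:Z t_gt1 q_def.
rewrite absz_nat -/g (gcdn_idPr (dvdn_div dg)).
by rewrite divnA // mulKn.
Qed.
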